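(* Let $l\ge 2$ be an integer, let $c>0$ and $\alpha\in(0,1)$, and let $q_n=1-\frac{c}{n^\alpha}$ (for $n$ large enough that $q_n\in(0,1)$). Then for any choice of integers $\{k_n\}_{n=1}^\infty$ with $1\le k_n\le n-l+1$, $$ \frac{\big((l-1)!\big)^2}{(2l)!}\, \frac{c^{\,l-1}\, l!}{n^{\alpha(l-1)}} \lesssim P_n^{q_n}(A^{(n)}_{l;k_n})\lesssim \frac1l\, \frac{c^{\,l-1}\, l!}{n^{\alpha(l-1)}}\quad\text{as } n\to\infty, $$ and the asymptotics are uniform over all such sequences $\{k_n\}_{n=1}^\infty$. If moreover $\lim_{n\to\infty}\frac{\min(k_n,n-k_n)}{n^\alpha}=\infty$, then the improved upper bound holds: $$ \frac{\big((l-1)!\big)^2}{(2l)!}\, \frac{c^{\,l-1}\, l!}{n^{\alpha(l-1)}} \lesssim P_n^{q_n}(A^{(n)}_{l;k_n})\lesssim \Big(\int_0^1x^{l-1}e^{-(l-1)x}\,dx\Big)\, \frac{c^{\,l-1}\, l!}{n^{\alpha(l-1)}}\quad\text{as } n\to\infty. $$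
   Context: $S_n$ is the set of permutations $\sigma=\sigma_1\sigma_2\cdots\sigma_n$ of $[n]=\{1,\dots,n\}$. For $q>0$, the Mallows distribution with parameter $q$ is the probability measure on $S_n$ given by $P_n^q(\sigma)=\frac{q^{\mathrm{inv}(\sigma)}}{Z_n(q)}$, where $\mathrm{inv}(\sigma)$ is the number of inversions of $\sigma$ and $Z_n(q)$ is the normalizing constant, $Z_n(q)=\prod_{k=1}^n\frac{1-q^k}{1-q}$ (for $q\ne1$). For $l\ge2$ and $1\le k\le n-l+1$, $A^{(n)}_{l;k}\subset S_n$ is the event that the set of $l$ consecutive numbers $\{k,k+1,\dots,k+l-1\}$ appears in a set of $l$ consecutive positions, i.e. there exists $m\in\{1,\dots,n-l+1\}$ with $\{k,k+1,\dots,k+l-1\}=\{\sigma_m,\sigma_{m+1},\dots,\sigma_{m+l-1}\}$. The notation $a_n\lesssim b_n$ as $n\to\infty$ means $\limsup_{n\to\infty}\frac{a_n}{b_n}\le1$. *)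

(* Defs.v *)
From HB Require Import structures.
From mathcomp Require Import all_boot all_order all_algebra all_fingroup.
From mathcomp Require Import all_classical all_reals all_analysis.
Set Implicit Arguments.
Unset Strict Implicit.
Unset Printing Implicit Defensive.
Import Order.TTheory GRing.Theory Num.Theory.
Import numFieldNormedType.Exports.
Local Open Scope classical_set_scope.
Local Open Scope ring_scope.

(* A permutation of [n] = {1, ..., n} is an element s of 'S_n; the ordinal i  *)
(* stands for the integer i + 1, both as a position and as a value, so that   *)
(* s i is sigma_(i + 1) shifted down by one.                                  *)

Definition inv (n : nat) (s : 'S_n) : nat :=
  #|[set p : 'I_n * 'I_n | (p.1 < p.2)%N && (s p.2 < s p.1)%N]%SET|.

Definition mallows_Z (R : realType) (n : nat) (q : R) : R :=
  \sum_(s : 'S_n) q ^+ inv s.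

Definition mallows (R : realType) (n : nat) (q : R) (s : 'S_n) : R :=
  q ^+ inv s / mallows_Z n q.

Definition mallows_prob (R : realType) (n : nat) (q : R) (A : {set 'S_n}) : R :=
  \sum_(s in A) mallows q s.

(* Here k and m are 1-based, as on paper: m + l <= n + 1 says that the l      *)
(* positions m, ..., m + l - 1 all lie in [n].                                *)
Definition cluster (n l k : nat) : {set 'S_n} :=
  [set s : 'S_n | [exists m : 'I_n.+1,
     [&& (1 <= m)%N, (m + l <= n + 1)%N
       & [set x : 'I_n | (k <= x.+1 < k + l)%N]%SET
           == [set s i | i : 'I_n & (m <= i.+1 < m + l)%N]%SET]]]%SET.

(* The constraint 1 <= k_n <= n - l + 1 is satisfiable only when l <= n; the  *)
(* terms k_n with n < l are left unconstrained.                               *)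
Definition admissible (l : nat) (k : nat -> nat) : Prop :=
  forall n : nat, (l <= n)%N -> (1 <= k n <= n - l + 1)%N.

Definition qseq (R : realType) (c alpha : R) (n : nat) : R :=
  1 - c / n%:R `^ alpha.

Definition cluster_prob (R : realType) (l : nat) (c alpha : R)
    (k : nat -> nat) (n : nat) : R :=
  mallows_prob (qseq c alpha n) (cluster n l (k n)).

Definition cluster_rate (R : realType) (l : nat) (c alpha : R) (n : nat) : R :=
  c ^+ l.-1 * l`!%:R / n%:R `^ (alpha * l.-1%:R).

Definition lesssim (R : realType) (a b : nat -> R) : Prop :=
  (limn_esup (fun n => (a n / b n)%:E) <= 1%:E)%E.

(* Uniform version of lesssim over a set K of integer sequences on which a    *)
(* and b depend: the threshold on n does not depend on the sequence.          *)
Definition lesssim_uniform (R : realType) (K : set (nat -> nat))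
    (a b : (nat -> nat) -> nat -> R) : Prop :=
  forall e : R, 0 < e ->
    exists N : nat, forall k : nat -> nat, K k ->
      forall n : nat, (N <= n)%N -> a k n / b k n <= 1 + e.

(* Main.v *)
(* Build a Mallows permutation by inserting the values in increasing order.   *)
(* Let r be the number of positions to the right of the block once the        *)
(* values k, ..., k + l - 1 are in place. Inserting a further value, the sum  *)
(* over r of the weight of the permutations with a block, against             *)
(* [r + 1] ... [r + l - 1], is multiplied by exactly [n + 1], which is also   *)
(* the factor gained by Z_n. Hence                                            *)
(*   E[[r + 1] ... [r + l - 1]; A] = [l]! S_k                                 *)
(* for an explicit S_k that does not depend on n. As [r + i] <= 1 / (1 - q),  *)
(* with near equality for large r, this gives (1 - q)^(l - 1) [l]! S_k as a   *)
(* lower bound for P(A) and, up to a factor tending to 1, as an upper bound;  *)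
(* small r is negligible by a second test function, q^((l - 1) r), which is   *)
(* also multiplied by a constant at each insertion.                           *)
(* Finally S_k is a weighted average of a decreasing sequence starting at     *)
(* 1 / [l], so it decreases in k from 1 / [l], and comparison of the sum with *)
(* an integral puts it above the integral of x^(l - 1) (1 - x)^(l - 1) minus  *)
(* a vanishing error, and in the bulk below that of x^(l - 1) e^(-(l - 1) x). *)

Require Import Defs.
From HB Require Import structures.
From mathcomp Require Import all_boot all_order all_algebra all_fingroup.
From mathcomp Require Import all_classical all_reals all_analysis.
From mathcomp Require Import ring lra zify.
Set Implicit Arguments.
Unset Strict Implicit.
Unset Printing Implicit Defensive.
Import Order.TTheory GRing.Theory Num.Theory.
Import numFieldNormedType.Exports.
Local Open Scope classical_set_scope.
Local Open Scope ring_scope.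

(** Throughout the second half, [l] is [m.+1]. A new maximum falls to the left of the block, keeping
    r, or to its right, raising r by one; the addition rule for q-integers makes the rising product
    an eigenfunction of insertion with the same eigenvalue as Z_n ([sum_block_weight_rise]). So P(A)
    is close to (1 - q)^m [l]! S_k as long as r is rarely small, which follows from Markov's
    inequality for q^(m r) ([sum_block_weight_exp]) when many values lie above the block. Otherwise
    reverse-complement symmetry ([mallows_cluster_rev]) supplies such values. The outcome is
    [mallows_cluster_ge] and [mallows_cluster_le].

    It remains to estimate S_k, which with x = q^a is a Riemann sum on a geometric mesh
    ([cluster_factorE]). The Beta integral m!^2 / (2m + 1)! bounds it from below
    ([cluster_factor_ge_beta]) and exceeds the claimed constant by the factor 2l. The value at k = 0
    gives 1/l from above for every k ([cluster_factor_le]), and 1 - x <= e^(-x) gives the bulk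
    constant once q^k vanishes ([cluster_factor_le_integral]). All error terms are powers q_n^j with
    j / n^alpha tending to infinity ([qseq_exp_cvg0]). *)

Definition qint (R : realType) (q : R) (n : nat) : R := \sum_(i < n) q ^+ i.

Definition qfact (R : realType) (q : R) (n : nat) : R :=
  \prod_(i < n) qint q i.+1.

(* 0-based: the positions s, ..., s + l - 1 carry the values k, ..., k + l - 1. *)
Definition block (n l k s : nat) (t : 'S_n) : bool :=
  [forall i : 'I_n, (s <= i < s + l)%N == (k <= t i < k + l)%N].

Definition block_weight (R : realType) (q : R) (n l k s : nat) : R :=
  \sum_(t : 'S_n | block l k s t) q ^+ Defs.inv t.

(** * Insertion of the largest value: inversions, blocks and weights *)

Lemma lift_perm_max_inj n (j j' : 'I_n.+1) (u u' : 'S_n) :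
  lift_perm j ord_max u = lift_perm j' ord_max u' -> j = j' /\ u = u'.
Proof.
move=> E.
have jj' : j = j'.
  apply: (@perm_inj _ (lift_perm j ord_max u)).
  by rewrite {2}E !lift_perm_id.
split=> //; subst j'; apply/permP => i.
have := congr1 (fun t : 'S_n.+1 => t (lift j i)) E.
by rewrite !lift_perm_lift => /lift_inj.
Qed.

Lemma sum_perm_max (V : nmodType) n (P : pred 'S_n.+1) (F : 'S_n.+1 -> V) :
  \sum_(t | P t) F t =
  \sum_(j < n.+1) \sum_(u : 'S_n | P (lift_perm j ord_max u))
    F (lift_perm j ord_max u).
Proof.
pose h (p : 'I_n.+1 * 'S_n) := lift_perm p.1 ord_max p.2.
rewrite (pair_big_dep xpredT (fun j u => P (lift_perm j ord_max u))
  (fun j u => F (lift_perm j ord_max u))) /=.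
rewrite (reindex h) //=; apply: onW_bij.
have h_inj : injective h.
  by move=> [j u] [j' u'] /lift_perm_max_inj[/= -> ->].
apply: inj_card_bij => //.
by rewrite card_prod card_ord !card_Sn factS.
Qed.

Lemma invE n (t : 'S_n) :
  Defs.inv t = (\sum_(i < n) \sum_(j < n) ((i < j) && (t j < t i)))%N.
Proof.
rewrite /Defs.inv -sum1_card pair_big /= big_mkcond /=.
by apply: eq_bigr => p _; rewrite inE; case: ifP.
Qed.

(** Only the [n - j] entries to the right of the new maximum form new inversions; the relative order
    of the others is unchanged. *)
Lemma inv_lift_max n (j : 'I_n.+1) (u : 'S_n) :
  Defs.inv (lift_perm j ord_max u) = (n - j + Defs.inv u)%N.
Proof.
have count_right m (a : nat) : (\sum_(i < m) (a <= i) = m - a)%N.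
  by elim: m => [|m IHm]; rewrite ?big_ord0 // big_ord_recr /= IHm; lia.
rewrite !invE (bigD1_ord j) //= (bigD1_ord j) //= ltnn add0n.
congr (_ + _)%N.
  rewrite -count_right; apply: eq_bigr => i _.
  rewrite lift_perm_id lift_perm_lift lift_max ltn_ord andbT /= /bump.
  by congr nat_of_bool; lia.
apply: eq_bigr => i _; rewrite (bigD1_ord j) //= lift_perm_id lift_perm_lift.
rewrite [X in (_ && X)%B]ltnNge leq_ord andbF add0n.
apply: eq_bigr => i' _; rewrite !lift_perm_lift !lift_max /= /bump.
by congr (nat_of_bool (_ && _)); lia.
Qed.

(** The inserted value is not a block value, so it cannot split the block; on its left it shifts the
    block by one. At [s = 0] the truncated [s.-1] is guarded by [j < s]. *)
Lemma block_lift_notin n l k s (j : 'I_n.+1) (u : 'S_n) : (k + l <= n)%N ->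
  block l k s (lift_perm j ord_max u) =
  (j < s)%N && block l k s.-1 u || (s + l <= j)%N && block l k s u.
Proof.
move=> kl; apply/forallP/orP => [H|H i].
  have := H j; rewrite lift_perm_id /= => Hj.
  have {}H (i : 'I_n) : ((s <= bump j i < s + l) = (k <= u i < k + l))%N.
    by have /eqP := H (lift j i); rewrite lift_perm_lift lift_max.
  have [js|js] := ltnP j s; [left|right; apply/andP; split; first by lia].
    by apply/forallP => i; rewrite -H /bump; apply/eqP; lia.
  by apply/forallP => i; rewrite -H /bump; apply/eqP; lia.
case: (unliftP j i) => [i'|] ->; last first.
  rewrite lift_perm_id /=; apply/eqP.
  by case: H => /andP[js _]; lia.
rewrite lift_perm_lift lift_max /=; apply/eqP.
by case: H => /andP[js /forallP/(_ i')/eqP <-]; rewrite /bump; lia.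
Qed.

Lemma block_lift_in l k s (j : 'I_(k + l).+1) (u : 'S_(k + l)) :
  block l.+1 k s (lift_perm j ord_max u) = (s <= j <= s + l)%N && block l k s u.
Proof.
apply/forallP/andP => [H|[js /forallP H] i].
  have := H j; rewrite lift_perm_id /= => Hj.
  split; first by lia.
  apply/forallP => i; have := H (lift j i).
  rewrite lift_perm_lift lift_max /= /bump; have := ltn_ord (u i).
  by move=> ui /eqP Hi; apply/eqP; lia.
case: (unliftP j i) => [i'|] ->; last first.
  by rewrite lift_perm_id /=; apply/eqP; lia.
rewrite lift_perm_lift lift_max /= /bump; have /eqP := H i'.
by have := ltn_ord (u i'); move=> ui Hi; apply/eqP; lia.
Qed.

Lemma sum_q_suffix (R : realType) (q : R) n a : (a <= n)%N ->
  \sum_(j < n | (a <= j)%N) q ^+ (n.-1 - j) = qint q (n - a).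
Proof.
move=> an; rewrite -(big_mkord (fun j => (a <= j)%N) (fun j => q ^+ (n.-1 - j))).
rewrite (big_cat_nat (leq0n a) an) /= big_nat_cond big1 ?add0r => [|i]; last by lia.
rewrite big_nat_cond (eq_bigl (fun i => (a <= i < n)%N)); last by move=> i; lia.
rewrite -big_nat -{1}[a]add0n big_addn big_mkord /qint.
rewrite [RHS](reindex_inj rev_ord_inj) /=.
by apply: eq_bigr => i _; congr (q ^+ _); have := ltn_ord i; lia.
Qed.

Lemma qintD (R : realType) (q : R) m n :
  qint q (m + n) = qint q m + q ^+ m * qint q n.
Proof.
rewrite /qint big_split_ord /= mulr_sumr; congr (_ + _).
by apply: eq_bigr => i _; rewrite exprD.
Qed.

Lemma sum_q_itv (R : realType) (q : R) n a b : (a <= b <= n)%N ->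
  \sum_(j < n | (a <= j < b)%N) q ^+ (n.-1 - j) = q ^+ (n - b) * qint q (b - a).
Proof.
move=> /andP[ab bn].
apply: (@addIr _ (qint q (n - b))); rewrite -{1}sum_q_suffix //.
rewrite addrC [in RHS]addrC -qintD (_ : n - b + (b - a) = n - a)%N; last by lia.
rewrite -sum_q_suffix ?(leq_trans ab) // [RHS](bigID (fun j : 'I_n => (b <= j)%N)) /=.
by congr (_ + _); apply: eq_bigl => j; lia.
Qed.

Lemma qfactS (R : realType) (q : R) n :
  qfact q n.+1 = qfact q n * qint q n.+1.
Proof. exact: big_ord_recr. Qed.

Lemma mallows_Z_qfact (R : realType) (q : R) n : mallows_Z n q = qfact q n.
Proof.
elim: n => [|n IHn].
  rewrite /mallows_Z /qfact big_ord0.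
  rewrite (eq_bigr (fun=> 1)) => [|t _].
    by rewrite sumr_const card_Sn.
  by rewrite (_ : Defs.inv t = 0%N) // invE big_ord0.
rewrite qfactS -IHn /mallows_Z sum_perm_max.
under eq_bigr => j _.
  under eq_bigr => u _ do rewrite inv_lift_max exprD.
  rewrite -mulr_sumr; over.
rewrite -mulr_suml mulrC; congr (_ * _).
by rewrite -[in RHS](subn0 n.+1) -sum_q_suffix.
Qed.

Lemma block_weight0 (R : realType) (q : R) k s :
  block_weight q k 0 k s = qfact q k.
Proof.
rewrite -mallows_Z_qfact /block_weight /mallows_Z; apply: eq_bigl => t.
apply/forallP => i; have := ltn_ord (t i). by move=> ?; apply/eqP; lia.
Qed.

(** All other values are smaller: each of the [l] block values is inverted with the [k - s] entries
    to the right of the block, and the two groups are ordered independently. *)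
Lemma block_weight_top (R : realType) (q : R) l k s : (s <= k)%N ->
  block_weight q (k + l) l k s = q ^+ (l * (k - s)) * qfact q l * qfact q k.
Proof.
move=> sk; elim: l => [|l IHl].
  by rewrite addn0 block_weight0 mul0n expr0 /qfact big_ord0 !mul1r.
rewrite addnS {1}/block_weight sum_perm_max.
rewrite (eq_bigr (fun j : 'I_(k + l).+1 => if (s <= j < (s + l).+1)%N
   then q ^+ (k + l - j) * block_weight q (k + l) l k s else 0)); last first.
  move=> j _; under eq_bigl => u do rewrite block_lift_in.
  under eq_bigr => u _ do rewrite inv_lift_max exprD.
  rewrite -mulr_sumr ltnS; case: ifP => _ //=.
  by rewrite big_pred0 // mulr0.
rewrite -big_mkcond -mulr_suml (@sum_q_itv _ _ (k + l).+1); last by lia.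
rewrite IHl // qfactS mulSn exprD.
rewrite (_ : (s + l).+1 - s = l.+1)%N; last by lia.
rewrite (_ : (k + l).+1 - (s + l).+1 = k - s)%N; last by lia.
by ring.
Qed.

Lemma block_weightS (R : realType) (q : R) n l k s :
  (k + l <= n)%N -> (s + l <= n.+1)%N ->
  block_weight q n.+1 l k s =
  q ^+ (n.+1 - s) * qint q s * block_weight q n l k s.-1 +
  qint q (n.+1 - (s + l)) * block_weight q n l k s.
Proof.
move=> kl sl; rewrite {1}/block_weight sum_perm_max.
rewrite (eq_bigr (fun j : 'I_n.+1 =>
   (if (0 <= j < s)%N then q ^+ (n - j) * block_weight q n l k s.-1 else 0) +
   (if (s + l <= j)%N then q ^+ (n - j) * block_weight q n l k s else 0))).
  rewrite big_split /= -!big_mkcond -!mulr_suml; congr (_ * _ + _ * _).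
    by rewrite (@sum_q_itv _ _ n.+1 0 s) ?subn0 //; lia.
  by rewrite (@sum_q_suffix _ _ n.+1).
move=> j _; under eq_bigl => u do rewrite block_lift_notin //.
under eq_bigr => u _ do rewrite inv_lift_max exprD.
rewrite -mulr_sumr.
have [js|js] /= := ltnP j s; have [sj|sj] /= := leqP (s + l) j; last 2 first.
- by rewrite add0r.
- by rewrite big_pred0 // mulr0 addr0.
- by lia.
- by rewrite addr0; under eq_bigl => u do rewrite orbF.
Qed.

(** * Reverse-complement symmetry *)

Lemma block_rev n l k s (t : 'S_n) (r := perm (@rev_ord_inj n)) :
  (k + l <= n)%N -> (s + l <= n)%N ->
  block l (n - l - k) (n - l - s) (r * t * r)%g = block l k s t.
Proof.
move=> kl sl; apply/forallP/forallP => H i.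
  have := H (rev_ord i); rewrite !permM !permE rev_ordK /=.
  by have := ltn_ord i; have := ltn_ord (t i) => ? ? /eqP E; apply/eqP; lia.
have := H (rev_ord i); rewrite !permM !permE /=.
by have := ltn_ord i; have := ltn_ord (t (rev_ord i)) => ? ? /eqP E; apply/eqP; lia.
Qed.

Lemma inv_rev n (t : 'S_n) (r := perm (@rev_ord_inj n)) :
  Defs.inv (r * t * r)%g = Defs.inv t.
Proof.
rewrite !invE exchange_big (reindex_inj rev_ord_inj) /=.
apply: eq_bigr => i _; rewrite (reindex_inj rev_ord_inj) /=.
apply: eq_bigr => j _; rewrite !permM !permE !rev_ordK /=.
congr nat_of_bool.
have := ltn_ord i; have := ltn_ord j; have := ltn_ord (t i); have := ltn_ord (t j).
lia.
Qed.

Lemma block_weight_rev (R : realType) (q : R) n l k s :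
  (k + l <= n)%N -> (s + l <= n)%N ->
  block_weight q n l (n - l - k) (n - l - s) = block_weight q n l k s.
Proof.
move=> kl sl; pose r := perm (@rev_ord_inj n).
rewrite /block_weight (reindex_inj (mulgI r)) (reindex_inj (mulIg r)) /=.
apply: eq_big => [t|t _]; first by rewrite mulgA block_rev.
by rewrite mulgA inv_rev.
Qed.

(** * The cluster event as a disjoint union of blocks *)

(** The conjunct [s + l <= n] matters when [n < l]: the truncated [n - l] still leaves the index
    0. *)
Lemma cluster_block n l k (t : 'S_n) : (0 < l)%N -> (0 < k)%N ->
  (t \in Defs.cluster n l k) =
  [exists s : 'I_(n - l).+1, (s + l <= n)%N && block l k.-1 s t].
Proof.
move=> l0 k0; rewrite inE.
have set_block (m : nat) : (0 < m)%N ->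
    ([set x : 'I_n | (k <= x.+1 < k + l)%N]%SET ==
     [set t i | i : 'I_n & (m <= i.+1 < m + l)%N]%SET) = block l k.-1 m.-1 t.
  move=> m0; apply/eqP/forallP => [/setP E i|H].
    by have := E (t i); rewrite (mem_imset _ _ (@perm_inj _ t)) !inE => Ei; apply/eqP; lia.
  apply/setP => x; rewrite -[x](permKV t) (mem_imset _ _ (@perm_inj _ t)) !inE.
  by have /eqP := H (t^-1 x)%g; lia.
apply/existsP/existsP => [[m /and3P[m1 ml]]|[s /andP[sl B]]].
  rewrite set_block // => B.
  have sn : (m.-1 < (n - l).+1)%N by lia.
  by exists (Ordinal sn) => /=; rewrite B andbT; lia.
have sn : (s.+1 < n.+1)%N by lia.
by exists (Ordinal sn); rewrite set_block //= B andbT addSn addn1 ltnS.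
Qed.

Lemma block_unique n l k s s' (t : 'S_n) : (0 < l)%N ->
  (s + l <= n)%N -> (s' + l <= n)%N ->
  block l k s t -> block l k s' t -> s = s'.
Proof.
move=> l0 sl sl' /forallP B /forallP B'.
have ss' (i : 'I_n) : (s <= i < s + l)%N = (s' <= i < s' + l)%N.
  by have /eqP -> := B i; have /eqP := B' i.
have sn : (s < n)%N by lia.
have sn' : (s' < n)%N by lia.
by have := ss' (Ordinal sn); have := ss' (Ordinal sn') => /=; lia.
Qed.

Lemma mallows_prob_cluster (R : realType) (q : R) n l k :
  (0 < l <= n)%N -> (0 < k)%N ->
  mallows_prob q (Defs.cluster n l k) =
  (\sum_(s < (n - l).+1) block_weight q n l k.-1 s) / qfact q n.
Proof.
move=> /andP[l0 ln] k0; rewrite /mallows_prob /mallows mallows_Z_qfact -mulr_suml.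
congr (_ / _); rewrite /block_weight (exchange_big_dep xpredT) //= big_mkcond /=.
apply: eq_bigr => t _; rewrite cluster_block //.
have sl (s : 'I_(n - l).+1) : (s + l <= n)%N by have := ltn_ord s; lia.
case: ifP => [/existsP[s /andP[_ B]]|/existsP N]; last first.
  by rewrite big_pred0 // => s; apply/negP => B; apply: N; exists s; rewrite sl.
rewrite (big_pred1 s) // => s' /=; apply/idP/eqP => [B'|-> //].
by apply: val_inj; apply: block_unique B' B.
Qed.

(** * Rising products of q-integers *)

Definition qrise (R : realType) (q : R) (a m : nat) : R :=
  \prod_(i < m) qint q (a + i).

(* The S_k of the header, with l = m.+1 and k shifted to be 0-based.          *)
Definition cluster_factor (R : realType) (q : R) (m k : nat) : R :=
  (\sum_(a < k.+1) q ^+ (m.+1 * a) * qrise q a.+1 m) / qrise q k.+1 m.+1.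

Lemma qint0 (R : realType) (q : R) : qint q 0 = 0.
Proof. exact: big_ord0. Qed.

Lemma qintS (R : realType) (q : R) n : qint q n.+1 = qint q n + q ^+ n.
Proof. exact: big_ord_recr. Qed.

Lemma mul_onem_qint (R : realType) (q : R) n : (1 - q) * qint q n = 1 - q ^+ n.
Proof. by elim: n => [|n IHn]; rewrite ?qint0 ?qintS ?mulrDr ?IHn ?exprS; ring. Qed.

Lemma qint_gt0 (R : realType) (q : R) n : 0 < q -> 0 < qint q n.+1.
Proof.
move=> q0; elim: n => [|n IHn]; first by rewrite qintS qint0 add0r.
by rewrite qintS addr_gt0 ?exprn_gt0.
Qed.

Lemma qfact_gt0 (R : realType) (q : R) n : 0 < q -> 0 < qfact q n.
Proof. by move=> q0; apply: prodr_gt0 => i _; exact: qint_gt0. Qed.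

Lemma qrise_gt0 (R : realType) (q : R) a m : 0 < q -> 0 < qrise q a.+1 m.
Proof. by move=> q0; apply: prodr_gt0 => i _; exact: qint_gt0. Qed.

Lemma qriseSr (R : realType) (q : R) a m :
  qrise q a m.+1 = qrise q a m * qint q (a + m).
Proof. exact: big_ord_recr. Qed.

Lemma qriseSl (R : realType) (q : R) a m :
  qrise q a m.+1 = qint q a * qrise q a.+1 m.
Proof.
rewrite /qrise big_ord_recl addn0; congr (_ * _).
by apply: eq_bigr => i _; rewrite lift0 addSnnS.
Qed.

(** A discrete Leibniz rule. Summed over [a <= k] it telescopes: the weights q^a [m + 1]
    [qrise q a.+1 m] add up to [qrise q k.+1 m.+1]. *)
Lemma qrise_shift (R : realType) (q : R) a m :
  qrise q a.+1 m.+1 = qrise q a m.+1 + q ^+ a * qint q m.+1 * qrise q a.+1 m.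
Proof. by rewrite qriseSr qriseSl addSnnS qintD; ring. Qed.

Lemma qfactD (R : realType) (q : R) a m :
  qfact q (a + m) = qfact q a * qrise q a.+1 m.
Proof.
elim: m => [|m IHm]; first by rewrite addn0 /qrise big_ord0 mulr1.
by rewrite addnS qfactS IHm qriseSr addSn mulrA.
Qed.

Lemma mul_onem_qrise (R : realType) (q : R) a m :
  (1 - q) ^+ m * qrise q a m = \prod_(i < m) (1 - q ^+ (a + i)).
Proof.
elim: m => [|m IHm]; first by rewrite /qrise !big_ord0 mulr1.
by rewrite qriseSr exprS big_ord_recr /= -IHm -mul_onem_qint; ring.
Qed.

Lemma onem_prod_itv (R : realType) (q : R) a b m : 0 <= q <= 1 -> (b <= a)%N ->
  (1 - q ^+ b) ^+ m <= \prod_(i < m) (1 - q ^+ (a + i)) <= 1.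
Proof.
move=> /andP[q0 q1] ba; rewrite -[m in _ ^+ m]card_ord -prodr_const.
apply/andP; split.
  apply: ler_prod => i _; rewrite subr_ge0 exprn_ile1 //= lerB //.
  by rewrite ler_wiXn2l //; lia.
apply: prodr_ile1 => i _; rewrite subr_ge0 exprn_ile1 //=.
by rewrite gerBl exprn_ge0.
Qed.

(** * Test functions multiplied by a constant at each insertion *)

(** The adjoint form of [block_weightS]: insertion acts on the test function instead of on the
    weights. *)
Lemma sum_block_weightS (R : realType) (q : R) n l k (f : nat -> R) :
  (k + l <= n)%N ->
  \sum_(s < (n.+1 - l).+1) block_weight q n.+1 l k s * f s =
  \sum_(s < (n - l).+1) block_weight q n l k s *
    (q ^+ (n - s) * qint q s.+1 * f s.+1 + qint q (n.+1 - (s + l)) * f s).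
Proof.
move=> kl; rewrite subSn; last by lia.
have step (s : 'I_(n - l).+2) : block_weight q n.+1 l k s * f s =
    q ^+ (n.+1 - s) * qint q s * block_weight q n l k s.-1 * f s +
    qint q (n.+1 - (s + l)) * block_weight q n l k s * f s.
  by rewrite block_weightS ?mulrDl //; have := ltn_ord s; lia.
under eq_bigr => s _ do rewrite step.
(* As [0] = 0, left insertion contributes nothing at [s = 0] and right insertion nothing at the last
   [s], so both parts reindex to the old range. *)
rewrite big_split /= big_ord_recl qint0 mulr0 !mul0r add0r.
rewrite [X in _ + X]big_ord_recr /=.
rewrite (_ : n.+1 - ((n - l).+1 + l) = 0)%N ?qint0 ?mul0r ?addr0; last by lia.
rewrite -big_split; apply: eq_bigr => s _ /=; rewrite /bump add1n subSS; ring.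
Qed.

Lemma block_weight_ge0 (R : realType) (q : R) n l k s :
  0 <= q -> 0 <= block_weight q n l k s.
Proof. by move=> q0; apply: sumr_ge0 => t _; rewrite exprn_ge0. Qed.

(* The s positions on the left of the block leave r = n - l - s on its right. *)
Lemma sum_block_weight_rise (R : realType) (q : R) n m k :
  0 < q -> (k + m.+1 <= n)%N ->
  \sum_(s < (n - m.+1).+1) block_weight q n m.+1 k s * qrise q (n - m.+1 - s).+1 m =
  qfact q n * qfact q m.+1 * cluster_factor q m k.
Proof.
move=> q0 /subnKC <-; move: (n - _)%N => d.
elim: d => [|d IHd].
  rewrite addn0 addnK qfactD /cluster_factor.
  rewrite (_ : qfact q k * _ * _ * _ = qfact q m.+1 * qfact q k *
     \sum_(a < k.+1) q ^+ (m.+1 * a) * qrise q a.+1 m); last first.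
    by field; rewrite gt_eqF // qrise_gt0.
  rewrite mulr_sumr (reindex_inj rev_ord_inj) /=.
  apply: eq_bigr => s _; rewrite subSS block_weight_top ?leq_subr //.
  rewrite subKn; last by rewrite -ltnS.
  by ring.
(* Left and right insertion contribute q^(r + m + 1) [s + 1] and [r + m + 1] times the same product;
   they add up to [n + 1], where n = r + m + 1 + s is the current size. *)
have step (s : nat) : (s < (k + m.+1 + d - m.+1).+1)%N ->
    q ^+ (k + m.+1 + d - s) * qint q s.+1 *
      qrise q ((k + m.+1 + d).+1 - m.+1 - s.+1).+1 m +
    qint q ((k + m.+1 + d).+1 - (s + m.+1)) *
      qrise q ((k + m.+1 + d).+1 - m.+1 - s).+1 m =
    qint q (k + m.+1 + d).+1 * qrise q (k + m.+1 + d - m.+1 - s).+1 m.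
  move=> sr; have [r rE] : exists r, r = (k + m.+1 + d - m.+1 - s)%N.
    by exists (k + m.+1 + d - m.+1 - s)%N.
  rewrite -rE (_ : (k + m.+1 + d).+1 - m.+1 - s.+1 = r)%N; last by lia.
  rewrite (_ : (k + m.+1 + d).+1 - m.+1 - s = r.+1)%N; last by lia.
  rewrite (_ : (k + m.+1 + d).+1 - (s + m.+1) = r.+1)%N; last by lia.
  rewrite -qriseSl qriseSr (_ : (k + m.+1 + d).+1 = (r.+1 + m) + s.+1)%N; last by lia.
  rewrite (qintD _ (r.+1 + m) s.+1) (_ : k + m.+1 + d - s = r.+1 + m)%N; last by lia.
  ring.
rewrite [(_ + d.+1)%N]addnS; set N := (k + m.+1 + d)%N in IHd step *.
rewrite (sum_block_weightS _ (fun s => qrise q (N.+1 - m.+1 - s).+1 m)) ?leq_addr // qfactS.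
rewrite [qfact _ _ * _]mulrC -2!mulrA [qfact _ _ * _]mulrA -IHd mulr_sumr.
apply: eq_bigr => s _; rewrite [RHS]mulrCA; congr (_ * _).
exact/step/ltn_ord.
Qed.

(** Inserting into size n multiplies the sum of q^(m r) by q^m [n + 1 - m]. After the [d] values
    above the block, this leaves the small factor q^(m d). *)
Lemma sum_block_weight_exp (R : realType) (q : R) m k d : 0 < q <= 1 ->
  \sum_(s < (k + d).+1) block_weight q (k + d + m.+1) m.+1 k s * q ^+ (m * (k + d - s))
  <= q ^+ (m * d) * qfact q m.+1 * qfact q (k + d).+1.
Proof.
move=> /andP[q0 q1]; elim: d => [|d IHd].
  (* Weight and test function give q^((m + 1) r) q^(m r); a single factor q^r is kept, so that the
     sum becomes [k + 1]. *)
  rewrite !addn0 muln0 expr0 mul1r (qfactS _ k) mulrA mulr_sumr.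
  rewrite [leRHS](reindex_inj rev_ord_inj) /=.
  apply: ler_sum => s _; rewrite block_weight_top; last by rewrite -ltnS.
  rewrite subSS -!mulrA mulrCA ler_pM2l ?qfact_gt0 // mulrCA ler_pM2l ?qfact_gt0 //.
  rewrite mulSn exprD -mulrA ler_piMr ?exprn_ge0 ?(ltW q0) //.
  by rewrite mulr_ile1 ?exprn_ge0 ?exprn_ile1 ?(ltW q0).
have := @sum_block_weightS _ q (k + d + m.+1) m.+1 k (fun s => q ^+ (m * (k + d.+1 - s))).
rewrite -addSn -addnS !addnK => -> ; last by lia.
rewrite (qfactS _ (k + d.+1)) mulnS exprD.
rewrite [leRHS](_ : _ = (q ^+ m * qint q (k + d.+1).+1) *
  (q ^+ (m * d) * qfact q m.+1 * qfact q (k + d).+1)); last by rewrite addnS; ring.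
apply: le_trans (ler_wpM2l _ IHd); last by rewrite mulr_ge0 ?exprn_ge0 ?ltW ?qint_gt0.
rewrite mulr_sumr; apply: ler_sum => s _.
rewrite mulrCA le_eqVlt; apply/orP; left; apply/eqP; congr (_ * _).
have : (s <= k + d)%N by rewrite -ltnS.
move: (nat_of_ord s) => {}s sr.
have [r rE] : exists r, r = (k + d - s)%N by exists (k + d - s)%N.
rewrite -rE (_ : k + d.+1 - s.+1 = r)%N; last by lia.
rewrite (_ : k + d.+1 - s = r.+1)%N; last by lia.
rewrite (_ : k + d.+1 + m.+1 - (s + m.+1) = r.+1)%N; last by lia.
rewrite (_ : k + d + m.+1 - s = r.+1 + m)%N; last by lia.
rewrite (_ : (k + d.+1).+1 = r.+1 + s.+1)%N; last by lia.
rewrite qintD mulnS !exprD; ring.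
Qed.

(** * Bounds on the probability at fixed n and q *)

Lemma mallows_cluster_ge (R : realType) (q : R) n m k :
  0 < q < 1 -> (k + m.+1 <= n)%N ->
  (1 - q) ^+ m * qfact q m.+1 * cluster_factor q m k <=
  mallows_prob q (Defs.cluster n m.+1 k.+1).
Proof.
move=> /andP[q0 q1] kn; rewrite mallows_prob_cluster //=; last by lia.
rewrite ler_pdivlMr ?qfact_gt0 //.
rewrite [leLHS](_ : _ = (1 - q) ^+ m * (qfact q n * qfact q m.+1 *
  cluster_factor q m k)); last by ring.
rewrite -sum_block_weight_rise // mulr_sumr; apply: ler_sum => s _.
rewrite mulrCA ler_piMr ?block_weight_ge0 ?(ltW q0) //.
have q01 : 0 <= q <= 1 by rewrite !ltW.
by rewrite mul_onem_qrise; have /andP[_] := onem_prod_itv m q01 (leq0n (n - m.+1 - s).+1).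
Qed.

Lemma cluster_factor_ge0 (R : realType) (q : R) m k : 0 < q -> 0 <= cluster_factor q m k.
Proof.
move=> q0; rewrite divr_ge0 ?(ltW (qrise_gt0 _ _ q0)) //; apply: sumr_ge0 => a _.
by rewrite mulr_ge0 ?exprn_ge0 ?(ltW q0) ?(ltW (qrise_gt0 _ _ q0)).
Qed.

Lemma mallows_cluster_le (R : realType) (q : R) m k d r :
  0 < q < 1 -> (r <= d)%N ->
  mallows_prob q (Defs.cluster (k + d + m.+1) m.+1 k.+1) *
    (1 - q ^+ r) ^+ (m + m) <=
  (1 - q) ^+ m * qfact q m.+1 * (cluster_factor q m k + q ^+ (m * (d - r))).
Proof.
move=> /andP[q0 q1] rd; have q01 : 0 <= q <= 1 by rewrite !ltW.
set n := (k + d + m.+1)%N.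
have kn : (k + m.+1 <= n)%N by rewrite /n; lia.
have nm : (n - m.+1 = k + d)%N by rewrite /n; lia.
have nms (s : nat) : (n - m.+1 - s = k + d - s)%N by rewrite nm.
rewrite mallows_prob_cluster //=; last by rewrite /n; lia.
rewrite mulrAC ler_pdivrMr ?qfact_gt0 //.
have W0 s : 0 <= block_weight q n m.+1 k s by rewrite block_weight_ge0 ?ltW.
(* With at least [r] entries to the right of the block, (1 - q)^m times the rising product is at
   least (1 - q^r)^m. *)
have far : (\sum_(s < (n - m.+1).+1 | (r <= k + d - s)%N) block_weight q n m.+1 k s) *
    (1 - q ^+ r) ^+ m <= (1 - q) ^+ m * (qfact q n * qfact q m.+1 * cluster_factor q m k).
  rewrite -sum_block_weight_rise // mulr_sumr mulr_suml big_mkcond.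
  apply: ler_sum => s _; rewrite mulrCA mul_onem_qrise nms; case: ifPn => rs.
    by rewrite ler_wpM2l //; have /andP[] := onem_prod_itv m q01 (leqW rs).
  rewrite mulr_ge0 //.
  have /andP[+ _] := onem_prod_itv m q01 (leq0n (k + d - s).+1).
  by apply: le_trans; rewrite expr0 subrr exprn_ge0.
(* Markov's inequality: with fewer than [r] entries to the right of the block, the test function is
   at least q^(m r). *)
have near : (\sum_(s < (n - m.+1).+1 | ~~ (r <= k + d - s)%N) block_weight q n m.+1 k s) <=
    q ^+ (m * (d - r)) * qfact q m.+1 * qfact q (k + d).+1.
  rewrite -(@ler_pM2l _ (q ^+ (m * r))) ?exprn_gt0 // 2!mulrA -exprD -mulnDr subnKC //.
  apply: le_trans (@sum_block_weight_exp _ q m k d _); last by rewrite q0 (ltW q1).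
  rewrite nm mulr_sumr big_mkcond; apply: ler_sum => s _.
  case: ifPn => rs; last by rewrite mulr_ge0 ?exprn_ge0 ?(ltW q0) ?W0.
  rewrite mulrC ler_wpM2l ?W0 // ler_wiXn2l ?(ltW q0) ?(ltW q1) // leq_mul2l.
  by apply/orP; right; lia.
(* Each of the [m] q-integers missing from [n]! is at least (1 - q^r) / (1 - q). *)
have Zn : qfact q (k + d).+1 * (1 - q ^+ r) ^+ m <= (1 - q) ^+ m * qfact q n.
  rewrite (_ : n = (k + d).+1 + m)%N; last by rewrite /n; lia.
  rewrite qfactD mulrCA mul_onem_qrise ler_pM2l ?qfact_gt0 //.
  have rkd : (r <= (k + d).+2)%N by lia.
  by have /andP[] := onem_prod_itv m q01 rkd.
have u0 : 0 <= (1 - q ^+ r) ^+ m 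
  by rewrite exprn_ge0 // subr_ge0 exprn_ile1 ?(ltW q0) ?(ltW q1).
have u1 : (1 - q ^+ r) ^+ m <= 1.
  by rewrite exprn_ile1 ?subr_ge0 ?exprn_ile1 ?gerBl ?exprn_ge0 ?(ltW q0) ?(ltW q1).
rewrite (bigID (fun s : 'I_(n - m.+1).+1 => (r <= k + d - s)%N)) /= exprD.
set A := \sum_(s < _ | _) _ in far *; set B := \sum_(s < _ | _) _ in near *.
set u := (1 - q ^+ r) ^+ m in far Zn u0 u1 *.
have A0 : 0 <= A * u by rewrite mulr_ge0 // sumr_ge0.
have C0 : 0 <= q ^+ (m * (d - r)) * qfact q m.+1.
  by rewrite mulr_ge0 ?exprn_ge0 ?(ltW q0) ?(ltW (qfact_gt0 _ q0)).
have Au : A * u * u <= A * u by rewrite ler_piMr.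
have Bu : B * (u * u) <= q ^+ (m * (d - r)) * qfact q m.+1 * ((1 - q) ^+ m * qfact q n).
  apply: le_trans (ler_wpM2l C0 Zn).
  apply: le_trans (_ : B * u <= _).
    by rewrite ler_wpM2l ?ler_piMr // sumr_ge0.
  by rewrite mulrA ler_wpM2r.
rewrite mulrDl [A * _]mulrA.
apply: le_trans (lerD (le_trans Au far) Bu) _.
by rewrite le_eqVlt; apply/orP; left; apply/eqP; ring.
Qed.

(** * Monotonicity of S_k *)

(** By [qrise_shift], [m + 1] S_k is a weighted mean of the q^(m a) with [a <= k], hence at least
    the smallest of them, q^(m k). *)
Lemma cluster_factor_lower (R : realType) (q : R) m k : 0 < q < 1 ->
  q ^+ (m * k) * qrise q k.+1 m.+1 <=
  (\sum_(a < k.+1) q ^+ (m.+1 * a) * qrise q a.+1 m) * qint q m.+1.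
Proof.
move=> /andP[q0 q1]; elim: k => [|k IHk].
  by rewrite muln0 mul1r big_ord_recr big_ord0 /= add0r muln0 mul1r qriseSr add1n.
rewrite big_ord_recr /= mulrDl.
apply: le_trans (lerD IHk (lexx _)).
rewrite (qrise_shift _ k.+1) mulrDr; apply: lerD.
  rewrite ler_wpM2r ?(ltW (qrise_gt0 _ _ q0)) //.
  by rewrite ler_wiXn2l ?(ltW q0) ?(ltW q1) // leq_mul2l leqnSn orbT.
by rewrite mulSn exprD le_eqVlt; apply/orP; left; apply/eqP; ring.
Qed.

(** Going from k to k + 1 adds to that mean the value q^(m (k + 1)), which does not exceed the
    current mean. *)
Lemma cluster_factor_nonincreasing (R : realType) (q : R) m k k' : 0 < q < 1 ->
  (k <= k')%N -> cluster_factor q m k' <= cluster_factor q m k.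
Proof.
move=> q01 /subnKC <-; elim: (k' - k)%N => [|d IHd]; first by rewrite addn0.
apply: le_trans IHd; rewrite addnS; move: (k + d)%N => {}k {k' d}.
have /andP[q0 q1] := q01.
rewrite ler_pdivrMr ?qrise_gt0 // mulrAC ler_pdivlMr ?qrise_gt0 //.
rewrite big_ord_recr /= mulrDl.
rewrite (qrise_shift _ k.+1) mulrDr lerD2l.
have := @cluster_factor_lower _ q m k q01.
set T := \sum_(a < _) _ => H.
rewrite mulSn exprD.
rewrite [leLHS](_ : _ = (q ^+ k.+1 * qrise q k.+2 m) *
  (q ^+ (m * k.+1) * qrise q k.+1 m.+1)); last by ring.
rewrite [leRHS](_ : _ = (q ^+ k.+1 * qrise q k.+2 m) * (T * qint q m.+1)); last by ring.
rewrite ler_wpM2l ?mulr_ge0 ?exprn_ge0 ?(ltW q0) ?(ltW (qrise_gt0 _ _ q0)) //.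
apply: le_trans H; rewrite ler_wpM2r ?(ltW (qrise_gt0 _ _ q0)) //.
by rewrite ler_wiXn2l ?(ltW q0) ?(ltW q1) // leq_mul2l leqnSn orbT.
Qed.

Lemma cluster_factor_le (R : realType) (q : R) m k : 0 < q < 1 ->
  cluster_factor q m k <= (qint q m.+1)^-1.
Proof.
move=> q01; have /andP[q0 q1] := q01.
apply: le_trans (@cluster_factor_nonincreasing _ q m 0 k q01 (leq0n k)) _.
rewrite /cluster_factor big_ord_recr big_ord0 /= add0r muln0 mul1r qriseSr add1n.
by rewrite invfM mulVKf ?gt_eqF ?qrise_gt0.
Qed.

(** * Comparison of S_k with integrals *)

(** With x = q^a, a summand is the width (1 - q) x of the cell [q x, x], times x^m, times [m]
    factors near 1 - x. *)
Lemma cluster_factorE (R : realType) (q : R) m k : 0 < q < 1 ->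
  cluster_factor q m k =
  ((1 - q) * \sum_(a < k.+1) q ^+ (m.+1 * a) * \prod_(i < m) (1 - q ^+ (a.+1 + i))) /
  \prod_(i < m.+1) (1 - q ^+ (k.+1 + i)).
Proof.
move=> /andP[q0 q1]; rewrite -mul_onem_qrise.
under eq_bigr => a _ do rewrite -mul_onem_qrise mulrCA.
rewrite -mulr_sumr mulrA -exprS /cluster_factor.
have : (1 - q) != 0 by rewrite subr_eq0 gt_eqF.
by move=> q1n; field; rewrite expf_neq0 // gt_eqF // qrise_gt0.
Qed.

Lemma integrable_continuous_itv (R : realType) (f : R -> R) (a b : R) :
  continuous f -> (@lebesgue_measure R).-integrable `[a, b] (EFin \o f).
Proof.
move=> cf; apply: continuous_compact_integrable; first exact: segment_compact.
exact: continuous_subspaceT.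
Qed.

Lemma integrable_continuous_itv_oc (R : realType) (f : R -> R) (a b : R) :
  continuous f -> (@lebesgue_measure R).-integrable `]a, b] (EFin \o f).
Proof.
move=> cf; apply: (integrableS _ _ _ (integrable_continuous_itv a b cf)) => //.
by apply: subset_itv; rewrite bnd_simp.
Qed.

Lemma Rintegral_itv_cst (R : realType) (x y c : R) : x <= y ->
  \int[lebesgue_measure]_(t in `]x, y]) c = (y - x) * c.
Proof.
move=> xy; rewrite Rintegral_cst; last exact: measurable_itv.
rewrite /= lebesgue_measure_itv /= lte_fin mulrC; congr (_ * _).
by case: ltP => //= yx; apply/eqP; rewrite eq_sym subr_eq0 eq_le xy yx.
Qed.

(** Stated for increments of a primitive, so that bounds on successive cells telescope. *)
Lemma Rintegral_sub_ge (R : realType) (f : R -> R) (a x y c : R) :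
  continuous f -> a <= x <= y -> (forall t, x <= t <= y -> c <= f t) ->
  (y - x) * c <= \int[lebesgue_measure]_(t in `[a, y]) f t -
    \int[lebesgue_measure]_(t in `[a, x]) f t.
Proof.
move=> cf /andP[ax xy] cle.
rewrite Rintegral_itvB ?bnd_simp //; last exact: integrable_continuous_itv.
rewrite -Rintegral_itv_cst //; apply: le_Rintegral => //=.
- exact/integrable_continuous_itv_oc/cst_continuous.
- exact: integrable_continuous_itv_oc.
by move=> t /=; rewrite in_itv /= => /andP[xt ty]; rewrite cle // (ltW xt).
Qed.

Lemma Rintegral_sub_le (R : realType) (f : R -> R) (a x y c : R) :
  continuous f -> a <= x <= y -> (forall t, x <= t <= y -> f t <= c) ->
  \int[lebesgue_measure]_(t in `[a, y]) f t -
    \int[lebesgue_measure]_(t in `[a, x]) f t <= (y - x) * c.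
Proof.
move=> cf /andP[ax xy] cge.
rewrite Rintegral_itvB ?bnd_simp //; last exact: integrable_continuous_itv.
rewrite -Rintegral_itv_cst //; apply: le_Rintegral => //=.
- exact: integrable_continuous_itv_oc.
- exact/integrable_continuous_itv_oc/cst_continuous.
by move=> t /=; rewrite in_itv /= => /andP[xt ty]; rewrite cge // (ltW xt).
Qed.

Lemma Rintegral_itv1 (R : realType) (f : R -> R) (a : R) :
  \int[lebesgue_measure]_(t in `[a, a]) f t = 0.
Proof. by rewrite set_itv1 Rintegral_set1. Qed.

Lemma Rintegral_beta (R : realType) (m : nat) :
  \int[lebesgue_measure]_(t in `[0 : R, 1]) (t ^+ m * (1 - t) ^+ m) =
  m`!%:R ^+ 2 / (2 * m).+1`!%:R.
Proof.
transitivity (beta_fun m.+1 m.+1 : R); first by rewrite /beta_fun -Rintegral_mkcond.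
by rewrite beta_fun_fact natrM addnn mul2n expr2.
Qed.

(** On [q^(a + 1), q^a] the integrand is at most q^(m a) (1 - q^(a + 1))^m, which the summand
    dominates. The cells miss [0, q^(k + 1)], at a cost of at most q^(k + 1); the denominator of S_k
    is at most 1. *)
Lemma cluster_factor_ge_beta (R : realType) (q : R) m k : 0 < q < 1 ->
  m`!%:R ^+ 2 / (2 * m).+1`!%:R - q ^+ k.+1 <= cluster_factor q m k.
Proof.
move=> q01; have /andP[q0 q1] := q01.
have q01' : 0 <= q <= 1 by rewrite !ltW.
pose f (t : R) := t ^+ m * (1 - t) ^+ m.
have cf : continuous f.
  move=> t; apply: cvgM; first exact: exprn_continuous.
  exact: continuous_onemXn.
pose F x := \int[lebesgue_measure]_(t in `[0, x]) f t.
have qa a : 0 <= q ^+ a <= 1 by rewrite exprn_ge0 ?exprn_ile1 ?(ltW q0) ?(ltW q1).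
have Fq : F (q ^+ k.+1) <= q ^+ k.+1.
  rewrite -[leLHS]subr0 -(Rintegral_itv1 f 0) -[leRHS]mulr1 -[in leRHS](subr0 (q ^+ k.+1)).
  apply: Rintegral_sub_le => //; first by rewrite lexx; case/andP: (qa k.+1).
  move=> t /andP[t0 t1]; have t1' : t <= 1 by rewrite (le_trans t1); case/andP: (qa k.+1).
  by rewrite mulr_ile1 ?exprn_ge0 ?exprn_ile1 ?subr_ge0 // gerBl.
rewrite -Rintegral_beta -/(F 1); apply: le_trans (lerB (lexx _) Fq) _.
rewrite cluster_factorE //.
have D0 : 0 < \prod_(i < m.+1) (1 - q ^+ (k.+1 + i)).
  by apply: prodr_gt0 => i _; rewrite subr_gt0 exprn_ilt1 ?(ltW q0).
rewrite ler_pdivlMr //; apply: le_trans (_ : F 1 - F (q ^+ k.+1) <= _).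
  rewrite ler_piMr //.
    rewrite subr_ge0 -subr_ge0; apply: le_trans (@Rintegral_sub_ge _ _ _ _ _ 0 _ _ _) => //.
    - by rewrite mulr0.
    - move=> t /andP[t0 t1]; rewrite mulr_ge0 ?exprn_ge0 ?subr_ge0 //.
      by apply: le_trans t0; case/andP: (qa k.+1).
  by have /andP[_] := onem_prod_itv m.+1 q01' (leq0n k.+1).
elim: k.+1 => [|K IHK]; first by rewrite expr0 subrr big_ord0 mulr0.
rewrite big_ord_recr mulrDr /=.
rewrite -(subrKA (F (q ^+ K))); apply: lerD IHK _.
have qK1 : q ^+ K.+1 <= q ^+ K by rewrite ler_wiXn2l ?(ltW q0) ?(ltW q1).
have [qK0 qKle] := andP (qa K); have [qS0 qSle] := andP (qa K.+1).
apply: le_trans (@Rintegral_sub_le _ f 0 _ _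
  (q ^+ (m * K) * (1 - q ^+ K.+1) ^+ m) _ _ _) _ => //.
- by rewrite qS0.
- move=> t /andP[t0 t1]; have tge0 := le_trans qS0 t0; have t1' := le_trans t1 qKle.
  rewrite mulnC exprM ler_pM ?exprn_ge0 ?subr_ge0 //.
    by rewrite lerXn2r ?nnegrE.
  by rewrite lerXn2r ?nnegrE ?subr_ge0 ?lerB.
have /andP[H _] := onem_prod_itv m q01' (leqnn K.+1).
rewrite [leRHS](_ : _ = (q ^+ K - q ^+ K.+1) * (q ^+ (m * K) *
  \prod_(i < m) (1 - q ^+ (K.+1 + i)))); last by rewrite mulSn exprD exprS; ring.
by rewrite ler_wpM2l ?subr_ge0 // ler_wpM2l // exprn_ge0 ?(ltW q0).
Qed.

(* Bounds the variation of x^m e^(-mx) over the mesh [q^(a + 1), q^a].        *)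
Definition riemann_error (R : realType) (m : nat) (q : R) : R :=
  expR (m%:R * (1 - q ^+ m)) / q ^+ m.

(** Each factor of the summand is at most 1 - q^(a + m) <= e^(-q^(a + m)). Passing to the lower
    bound q^(m (a + 1)) e^(-m q^a) of the integrand on the cell costs [riemann_error]. *)
Lemma cluster_factor_le_integral (R : realType) (q : R) m k : 0 < q < 1 ->
  cluster_factor q m k * (1 - q ^+ k.+1) ^+ m.+1 <=
  riemann_error m q *
    \int[lebesgue_measure]_(t in `[0 : R, 1]) (t ^+ m * expR (- (m%:R * t))).
Proof.
move=> q01; have /andP[q0 q1] := q01.
have q01' : 0 <= q <= 1 by rewrite !ltW.
pose f (t : R) := t ^+ m * expR (- (m%:R * t)).
have cf : continuous f.
  move=> t; apply: cvgM; first exact: exprn_continuous.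
  apply: (@continuous_comp _ _ _ (fun t : R => - (m%:R * t)) expR);
    last exact: continuous_expR.
  by apply: cvgN; apply: cvgM; [exact: cvg_cst|exact: cvg_id].
pose F x := \int[lebesgue_measure]_(t in `[0, x]) f t.
have qa a : 0 <= q ^+ a <= 1 by rewrite exprn_ge0 ?exprn_ile1 ?(ltW q0) ?(ltW q1).
have e0 : 0 < riemann_error m q by rewrite divr_gt0 ?expR_gt0 ?exprn_gt0.
rewrite -/(F 1).
apply: le_trans (_ : riemann_error m q * (F 1 - F (q ^+ k.+1)) <= _); last first.
  rewrite ler_wpM2l ?(ltW e0) // gerBl; apply: Rintegral_ge0 => t /=.
  by rewrite in_itv /= => /andP[t0 _]; rewrite mulr_ge0 ?exprn_ge0 ?expR_ge0.
rewrite cluster_factorE //.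
have D0 : 0 < \prod_(i < m.+1) (1 - q ^+ (k.+1 + i)).
  by apply: prodr_gt0 => i _; rewrite subr_gt0 exprn_ilt1 ?(ltW q0).
rewrite mulrAC ler_pdivrMr //.
set T := \sum_(a < _) _.
have T0 : 0 <= (1 - q) * T.
  rewrite mulr_ge0 ?subr_ge0 ?(ltW q1) //; apply: sumr_ge0 => a _.
  rewrite mulr_ge0 ?exprn_ge0 ?(ltW q0) //.
  by apply: prodr_ge0 => i _; rewrite subr_ge0; case/andP: (qa (a.+1 + i)%N).
have /andP[Dge _] := onem_prod_itv m.+1 q01' (leqnn k.+1).
apply: ler_pM => //.
  by rewrite exprn_ge0 // subr_ge0; case/andP: (qa k.+1).
rewrite /T; elim: k.+1 => [|K IHK].
  by rewrite expr0 subrr big_ord0 !mulr0.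
rewrite big_ord_recr mulrDr /=.
rewrite -(subrKA (F (q ^+ K)) (F 1)) mulrDr; apply: lerD IHK _.
have qK1 : q ^+ K.+1 <= q ^+ K by rewrite ler_wiXn2l ?(ltW q0) ?(ltW q1).
have [qK0 qKle] := andP (qa K); have [qS0 qSle] := andP (qa K.+1).
apply: le_trans (ler_wpM2l (ltW e0) (@Rintegral_sub_ge _ f 0 _ _
    ((q ^+ K.+1) ^+ m * expR (- (m%:R * q ^+ K))) cf _ _)).
- rewrite [leLHS](_ : _ = (q ^+ K - q ^+ K.+1) * (q ^+ (m * K) *
    \prod_(i < m) (1 - q ^+ (K.+1 + i)))); last by rewrite mulSn exprD exprS; ring.
  rewrite [leRHS]mulrCA ler_wpM2l ?subr_ge0 // /riemann_error.
  rewrite [leRHS](_ : _ = q ^+ (m * K) *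
    (expR (m%:R * (1 - q ^+ m)) * expR (- (m%:R * q ^+ K)))); last first.
    rewrite exprS exprMn -exprM [(K * m)%N]mulnC; field.
    by rewrite expf_neq0 // gt_eqF.
  rewrite ler_wpM2l ?exprn_ge0 ?(ltW q0) // -expRD.
  apply: le_trans (_ : expR (- q ^+ (K + m)) ^+ m <= _).
    rewrite -[m in _ ^+ m]card_ord -prodr_const; apply: ler_prod => i _.
    rewrite subr_ge0; case/andP: (qa (K.+1 + i)%N) => _ -> /=.
    apply: le_trans (expR_ge1Dx _); rewrite lerD2l lerN2.
    by rewrite ler_wiXn2l ?(ltW q0) ?(ltW q1) // addSnnS leq_add2l.
  (* The exponents differ by m q^K (1 - q^m), at most m (1 - q^m). *)
  rewrite -expRM_natl ler_expR -mulrN -mulrDr ler_wpM2l // exprD.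
  have [qm0 qm1] := andP (qa m).
  rewrite -subr_ge0 [leRHS](_ : _ = (1 - q ^+ K) * (1 - q ^+ m)); last by ring.
  by rewrite mulr_ge0 // subr_ge0.
- by rewrite qS0.
- move=> t /andP[t0 t1]; have tge0 := le_trans qS0 t0.
  rewrite ler_pM ?exprn_ge0 ?expR_ge0 ?(ltW q0) //; first by rewrite lerXn2r ?nnegrE.
  by rewrite ler_expR lerN2 ler_wpM2l.
Qed.

(** * Limits along q_n = 1 - c / n^alpha *)

Lemma powR_natr_cvgy (R : realType) (a : R) : 0 < a ->
  (n%:R : R) `^ a @[n --> \oo] --> +oo.
Proof.
move=> a0; apply/cvgryPge => A; near=> n.
apply: le_trans (_ : Num.max A 0 <= _); first by rewrite le_max lexx.
have M0 : 0 <= Num.max A 0 by rewrite le_max lexx orbT.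
rewrite [leLHS](_ : _ = (Num.max A 0 `^ a^-1) `^ a); last first.
  by rewrite -powRrM mulVf ?powRr1 // gt_eqF.
rewrite ge0_ler_powR ?nnegrE ?powR_ge0 ?(ltW a0) //.
by near: n; exact: nbhs_infty_ger.
Unshelve. all: by end_near. Qed.

Lemma qseq_cvg1 (R : realType) (c alpha : R) : 0 < alpha ->
  qseq c alpha n @[n --> \oo] --> (1 : R).
Proof.
move=> a0; rewrite -[X in _ --> X](subr0 1) -[X in _ - X](mulr0 c).
apply: cvgB; first exact: cvg_cst.
apply: cvgM; first exact: cvg_cst.
apply/gtr0_cvgV0; last exact: powR_natr_cvgy.
by near=> n; rewrite powR_gt0 // ltr0n; near: n; exact: nbhs_infty_gt.
Unshelve. all: by end_near. Qed.

Lemma qseq_gt0_lt1 (R : realType) (c alpha : R) : 0 < c -> 0 < alpha ->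
  \forall n \near \oo, 0 < qseq c alpha n < 1.
Proof.
move=> c0 a0; near=> n; apply/andP; split.
  by near: n; apply: cvgr_gt (qseq_cvg1 c a0) _ _.
rewrite gtrBl divr_gt0 // powR_gt0 // ltr0n.
by near: n; exact: nbhs_infty_gt.
Unshelve. all: by end_near. Qed.

(** From 1 - x <= e^(-x), the power is at most e^(-c j / n^alpha). *)
Lemma qseq_exp_cvg0 (R : realType) (c alpha : R) (j : nat -> nat) :
  0 < c -> 0 < alpha -> (j n)%:R / n%:R `^ alpha @[n --> \oo] --> +oo ->
  qseq c alpha n ^+ j n @[n --> \oo] --> (0 : R).
Proof.
move=> c0 a0 jy.
have cjy : c * ((j n)%:R / n%:R `^ alpha) @[n --> \oo] --> +oo.
  apply/cvgryPge => A; near=> n; rewrite mulrC -ler_pdivrMr //.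
  by near: n; exact: cvgry_ge.
have /cvg_pinftyP/(_ _ cjy) := @cvgr_expR R.
apply: squeeze_cvgr (cvg_cst _); near=> n.
have /andP[q0 _] : 0 < qseq c alpha n < 1 by near: n; exact: qseq_gt0_lt1.
rewrite exprn_ge0 ?(ltW q0) //= mulrCA -mulrN expRM_natl.
by rewrite lerXn2r ?nnegrE ?(ltW q0) ?expR_ge0 // expR_ge1Dx.
Unshelve. all: by end_near. Qed.

Lemma cvg_exprn (R : realType) (u : nat -> R) (a : R) (m : nat) :
  u n @[n --> \oo] --> a -> u n ^+ m @[n --> \oo] --> a ^+ m.
Proof.
move=> ua; apply: (@cvg_comp _ _ _ u (fun x => x ^+ m) _ _ _ ua).
exact: exprn_continuous.
Qed.

Lemma cvg_qint (R : realType) (q : nat -> R) (l : nat) :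
  q n @[n --> \oo] --> (1 : R) -> qint (q n) l @[n --> \oo] --> (l%:R : R).
Proof.
move=> q1; elim: l => [|l IHl].
  by under eq_cvg do rewrite qint0; exact: cvg_cst.
under eq_cvg do rewrite qintS.
rewrite -natr1; apply: cvgD IHl _; rewrite -[X in _ --> X](expr1n _ l).
exact: cvg_exprn.
Qed.

Lemma cvg_qfact (R : realType) (q : nat -> R) (l : nat) :
  q n @[n --> \oo] --> (1 : R) -> qfact (q n) l @[n --> \oo] --> (l`!%:R : R).
Proof.
move=> q1; elim: l => [|l IHl].
  by rewrite /qfact; under eq_cvg do rewrite big_ord0; exact: cvg_cst.
under eq_cvg do rewrite qfactS.
by rewrite factS mulnC natrM; apply: cvgM IHl _; exact: cvg_qint.
Qed.

Lemma cvg_riemann_error (R : realType) (q : nat -> R) (m : nat) :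
  q n @[n --> \oo] --> (1 : R) -> riemann_error m (q n) @[n --> \oo] --> (1 : R).
Proof.
move=> q1; have qm : q n ^+ m @[n --> \oo] --> (1 : R).
  by rewrite -[X in _ --> X](expr1n _ m); exact: cvg_exprn.
suff : riemann_error m (q n) @[n --> \oo] --> expR (m%:R * (1 - 1)) / 1.
  by rewrite subrr mulr0 expR0 divr1.
apply: cvgM; last by apply: cvgV.
apply: (@cvg_comp _ _ _ (fun n => m%:R * (1 - q n ^+ m)) expR);
  last exact: continuous_expR.
by apply: cvgM; [exact: cvg_cst|apply: cvgB => //; exact: cvg_cst].
Qed.

Lemma cluster_rateE (R : realType) (m : nat) (c alpha : R) (n : nat) :
  cluster_rate m.+1 c alpha n = (1 - qseq c alpha n) ^+ m * (m.+1)`!%:R.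
Proof.
rewrite /cluster_rate /qseq /= subKr expr_div_n powRrM powR_mulrn ?powR_ge0 //.
by rewrite mulrAC.
Qed.

Lemma lesssim_near (R : realType) (a b : nat -> R) :
  (forall e, 0 < e -> \forall n \near \oo, a n / b n <= 1 + e) -> lesssim a b.
Proof.
(* The upper limit is an infimum of suprema over neighbourhoods of infinity, so one tail suffices
   for each [e]. *)
move=> ab; apply/lee_addgt0Pr => e e0; have [N _ HN] := ab e e0.
apply: le_trans (ereal_inf_lbound _) _.
  by exists [set n | (N <= n)%N] => //; exists N.
by apply: ge_ereal_sup => _ [n /= Nn <-]; rewrite -EFinD lee_fin HN.
Qed.

Lemma lesssim_uniform_in (R : realType) (K : set (nat -> nat))
    (a b : (nat -> nat) -> nat -> R) (k : nat -> nat) :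
  lesssim_uniform K a b -> K k -> lesssim (a k) (b k).
Proof.
move=> ab Kk; apply: lesssim_near => e /ab[N /(_ k Kk) HN].
by exists N.
Qed.

(** * Upper bounds with a single error term *)

Lemma qfact_le_fact (R : realType) (q : R) (l : nat) : 0 <= q <= 1 ->
  qfact q l <= l`!%:R.
Proof.
move=> /andP[q0 q1]; rewrite fact_prod big_add1 /= big_mkord natr_prod.
apply: ler_prod => i _; rewrite sumr_ge0 => [|j _]; last by rewrite exprn_ge0.
rewrite -[X in _ <= X%:R]card_ord -sumr_const; apply: ler_sum => j _.
by rewrite exprn_ile1.
Qed.

Lemma mallows_cluster_rev (R : realType) (q : R) n l k :
  (0 < l)%N -> (k + l <= n)%N ->
  mallows_prob q (Defs.cluster n l (n - l - k).+1) =
  mallows_prob q (Defs.cluster n l k.+1).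
Proof.
move=> l0 kl; rewrite !mallows_prob_cluster //=; try by lia.
congr (_ / _); rewrite (reindex_inj rev_ord_inj) /=; apply: eq_bigr => s _.
by rewrite subSS block_weight_rev //; have := ltn_ord s; lia.
Qed.

(** Taking [r] at most half of [d] gives m (d - r) >= r, so q^r controls both errors. *)
Lemma mallows_cluster_le_half (R : realType) (q : R) m k d r :
  0 < q < 1 -> (0 < m)%N -> (r.*2 <= d)%N ->
  mallows_prob q (Defs.cluster (k + d + m.+1) m.+1 k.+1) *
    (1 - q ^+ r) ^+ (m + m) <=
  (1 - q) ^+ m * (m.+1)`!%:R * (cluster_factor q m k + q ^+ r).
Proof.
move=> q01 m0 rd; have /andP[q0 q1] := q01.
apply: le_trans (mallows_cluster_le m k q01 (_ : (r <= d)%N)) _; first by lia.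
have q01' : 0 <= q <= 1 by rewrite !ltW.
rewrite -!mulrA ler_wpM2l ?exprn_ge0 ?subr_ge0 ?(ltW q1) //.
have rmd : (r <= m * (d - r))%N.
  by apply: leq_trans (leq_pmull _ m0); lia.
apply: ler_pM; rewrite ?(ltW (qfact_gt0 _ q0)) ?qfact_le_fact //.
  by rewrite addr_ge0 ?cluster_factor_ge0 ?exprn_ge0 ?(ltW q0).
by rewrite lerD2l ler_wiXn2l ?(ltW q0) ?(ltW q1).
Qed.

(** By symmetry at least half of the [n - m.+1] other values lie above the block; the threshold is
    half of that half, hence the quarter. *)
Lemma mallows_cluster_le_unif (R : realType) (q : R) m n k :
  0 < q < 1 -> (0 < m)%N -> (k + m.+1 <= n)%N ->
  mallows_prob q (Defs.cluster n m.+1 k.+1) *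
    (1 - q ^+ ((n - m.+1) %/ 4)) ^+ (m + m) <=
  (1 - q) ^+ m * (m.+1)`!%:R * ((qint q m.+1)^-1 + q ^+ ((n - m.+1) %/ 4)).
Proof.
move=> q01 m0; have /andP[q0 q1] := q01.
wlog kn : k / (k.*2 <= n - m.+1)%N => [hw|] kl.
  have [kn|kn] := leqP k.*2 (n - m.+1); first exact: hw.
  by rewrite -mallows_cluster_rev //; apply: hw; lia.
have [d nE] : exists d, n = (k + d + m.+1)%N by exists (n - m.+1 - k)%N; lia.
subst n; apply: le_trans (mallows_cluster_le_half k q01 m0 (_ : (_ <= d)%N)) _.
  by lia.
rewrite ler_wpM2l ?mulr_ge0 ?exprn_ge0 ?subr_ge0 ?(ltW q1) //.
by rewrite lerD2r cluster_factor_le.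
Qed.

(** Absorbs the shifts and roundings in the exponents to which [qseq_exp_cvg0] is applied. *)
Lemma cvgy_affine (R : realType) (alpha : R) (u v : nat -> nat) (a b : nat) :
  0 < alpha -> (0 < a)%N -> (forall n, (v n <= a * u n + b)%N) ->
  (v n)%:R / (n%:R : R) `^ alpha @[n --> \oo] --> +oo ->
  (u n)%:R / (n%:R : R) `^ alpha @[n --> \oo] --> +oo.
Proof.
move=> al0 a0 vu vy; apply/cvgryPge => A; near=> n.
have n1 : 1 <= n%:R `^ alpha :> R.
  by near: n; exact: (cvgry_ge (powR_natr_cvgy al0)).
have n0 : 0 < n%:R `^ alpha :> R := lt_le_trans ltr01 n1.
have vn : a%:R * A + b%:R <= (v n)%:R / n%:R `^ alpha.
  by near: n; exact: cvgry_ge.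
rewrite ler_pdivlMr // -(@ler_pM2l _ a%:R) ?ltr0n //.
rewrite ler_pdivlMr // mulrDl in vn.
have := vu n; rewrite -(ler_nat R) natrD natrM.
have : b%:R * 1 <= b%:R * n%:R `^ alpha :> R by rewrite ler_wpM2l.
by rewrite mulr1 mulrA; lra.
Unshelve. all: by end_near. Qed.

Lemma natr_div_powR_cvgy (R : realType) (alpha : R) : alpha < 1 ->
  n%:R / (n%:R : R) `^ alpha @[n --> \oo] --> +oo.
Proof.
move=> al1; have al1' : 0 < 1 - alpha by rewrite subr_gt0.
apply/cvgryPge => A; near=> n.
have n0 : 0 < n%:R :> R by rewrite ltr0n; near: n; exact: nbhs_infty_gt.
rewrite (_ : _ / _ = n%:R `^ (1 - alpha)); last first.
  by rewrite powRB ?powRr1 ?(ltW n0) // (gt_eqF n0) implybT.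
by near: n; exact: (cvgry_ge (powR_natr_cvgy al1')).
Unshelve. all: by end_near. Qed.

(** * Asymptotic bounds *)

(** Uniformity comes from monotonicity: S_n bounds from below the factor of every admissible
    block. *)
Lemma cluster_prob_lower (R : realType) (m : nat) (c alpha : R) :
  0 < c -> 0 < alpha -> alpha < 1 ->
  lesssim_uniform [set k | admissible m.+1 k]
    (fun _ n => m`!%:R ^+ 2 / (2 * m.+1)`!%:R * cluster_rate m.+1 c alpha n)
    (cluster_prob m.+1 c alpha).
Proof.
move=> c0 al0 al1.
pose b : R := m`!%:R ^+ 2 / (2 * m).+1`!%:R.
have b0 : 0 < b by rewrite divr_gt0 ?exprn_gt0 // ltr0n fact_gt0.
pose q := qseq c alpha.
have qn0 : q n ^+ n.+1 @[n --> \oo] --> (0 : R).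
  apply: qseq_exp_cvg0 => //.
  apply: (@cvgy_affine _ _ _ _ 1 0 al0 isT _ (natr_div_powR_cvgy al1)).
  by move=> n; rewrite mul1n addn0 leqnSn.
have g1 : qfact (q n) m.+1 * (b - q n ^+ n.+1) @[n --> \oo] --> (m.+1)`!%:R * (b - 0).
  apply: cvgM; first exact/cvg_qfact/qseq_cvg1.
  by apply: cvgB => //; exact: cvg_cst.
(* The two sides differ by the factor 2m + 2; this strict gap absorbs the vanishing errors for large
   n. *)
have gb : m`!%:R ^+ 2 / (2 * m.+1)`!%:R * (m.+1)`!%:R < (m.+1)`!%:R * (b - 0).
  rewrite subr0 [ltRHS]mulrC ltr_pM2r ?ltr0n ?fact_gt0 //.
  rewrite mulnS factS natrM invfM mulrA mulrAC -/b gtr_pMr // invf_lt1 ?ltr0n //.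
  by rewrite ltr1n.
move=> e e0.
have [N _ HN] : \forall n \near \oo, [/\ (m.+1 <= n)%N, 0 < q n < 1 &
    m`!%:R ^+ 2 / (2 * m.+1)`!%:R * (m.+1)`!%:R <= qfact (q n) m.+1 * (b - q n ^+ n.+1)].
  near=> n; split; near: n.
  - exact: nbhs_infty_ge.
  - exact: qseq_gt0_lt1.
  - exact: cvgr_ge g1 _ gb.
exists N => k kadm n /HN[ln q01 gn].
have /andP[k1 kn] := kadm n ln; have /andP[q0 q1] := q01.
have r0 : 0 < (1 - q n) ^+ m by rewrite exprn_gt0 ?subr_gt0.
have low : m`!%:R ^+ 2 / (2 * m.+1)`!%:R * cluster_rate m.+1 c alpha n <=
    cluster_prob m.+1 c alpha k n.
  rewrite /cluster_prob -(prednK k1) -/(q n).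
  apply: le_trans (mallows_cluster_ge q01 (_ : _ <= n)%N); last by lia.
  rewrite cluster_rateE -/(q n) mulrCA -mulrA ler_wpM2l ?(ltW r0) //.
  apply: le_trans gn _; rewrite ler_wpM2l ?(ltW (qfact_gt0 _ q0)) //.
  apply: le_trans (cluster_factor_ge_beta m n q01) _.
  by apply: cluster_factor_nonincreasing => //; lia.
have p0 : 0 < cluster_prob m.+1 c alpha k n.
  apply: lt_le_trans low; rewrite cluster_rateE -/(q n).
  by rewrite mulr_gt0 ?divr_gt0 ?mulr_gt0 ?exprn_gt0 ?ltr0n ?fact_gt0 ?subr_gt0.
by rewrite ler_pdivrMr // (le_trans low) // ler_peMl ?(ltW p0) // lerDl ltW.
Unshelve. all: by end_near. Qed.

Lemma cluster_prob_upper (R : realType) (m : nat) (c alpha : R) :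
  (0 < m)%N -> 0 < c -> 0 < alpha -> alpha < 1 ->
  lesssim_uniform [set k | admissible m.+1 k]
    (cluster_prob m.+1 c alpha)
    (fun _ n => (m.+1)%:R^-1 * cluster_rate m.+1 c alpha n).
Proof.
move=> m0 c0 al0 al1; pose q := qseq c alpha; pose r n := ((n - m.+1) %/ 4)%N.
have z0 : q n ^+ r n @[n --> \oo] --> (0 : R).
  apply: qseq_exp_cvg0 => //.
  apply: (@cvgy_affine _ _ _ _ 4 (m + 4) al0 isT _ (natr_div_powR_cvgy al1)).
  by move=> n; rewrite /r; lia.
have g1 : (m.+1)%:R * ((qint (q n) m.+1)^-1 + q n ^+ r n) / (1 - q n ^+ r n) ^+ (m + m)
    @[n --> \oo] --> (1 : R).
  suff : (m.+1)%:R * ((qint (q n) m.+1)^-1 + q n ^+ r n) / (1 - q n ^+ r n) ^+ (m + m)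
      @[n --> \oo] --> ((m.+1)%:R * ((m.+1)%:R^-1 + 0) / (1 - 0) ^+ (m + m) : R).
    by rewrite addr0 divff ?pnatr_eq0 // subr0 expr1n divr1.
  apply: cvgM; last first.
    apply: cvgV; first by rewrite subr0 expr1n oner_neq0.
    by apply: cvg_exprn; apply: cvgB => //; exact: cvg_cst.
  apply: cvgM; first exact: cvg_cst.
  apply: cvgD => //; apply: cvgV; first by rewrite pnatr_eq0.
  exact/cvg_qint/qseq_cvg1.
move=> e e0.
have [N _ HN] : \forall n \near \oo, [/\ (m.+1 <= n)%N, 0 < q n < 1, q n ^+ r n < 1 &
    (m.+1)%:R * ((qint (q n) m.+1)^-1 + q n ^+ r n) / (1 - q n ^+ r n) ^+ (m + m) <= 1 + e].
  near=> n; split; near: n.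
  - exact: nbhs_infty_ge.
  - exact: qseq_gt0_lt1.
  - exact: cvgr_lt z0 _ ltr01.
  - by apply: cvgr_le g1 _ _; rewrite ltrDl.
exists N => k kadm n /HN[ln q01 r1 gn].
have /andP[k1 kn] := kadm n ln; have /andP[q0 q1] := q01.
apply: le_trans gn.
have rt0 : 0 < (1 - q n) ^+ m * (m.+1)`!%:R.
  by rewrite mulr_gt0 ?exprn_gt0 ?subr_gt0 // ltr0n fact_gt0.
rewrite cluster_rateE -/(q n).
rewrite ler_pdivrMr ?mulr_gt0 ?invr_gt0 ?ltr0n ?exprn_gt0 ?subr_gt0 ?fact_gt0 //.
rewrite mulrAC ler_pdivlMr ?exprn_gt0 ?subr_gt0 //.
rewrite [leRHS](_ : _ = (1 - q n) ^+ m * (m.+1)`!%:R *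
  ((qint (q n) m.+1)^-1 + q n ^+ r n)); last first.
  by field; rewrite gt_eqF ?qint_gt0 // addrC natr1 pnatr_eq0.
rewrite /cluster_prob -/(q n) -(prednK k1).
by apply: mallows_cluster_le_unif => //; lia.
Unshelve. all: by end_near. Qed.

(** Read off from [cluster_factor_le_integral] at q = 1/2 and k = 0, where the left side is
    positive. *)
Lemma exp_integral_gt0 (R : realType) (m : nat) :
  0 < \int[lebesgue_measure]_(t in `[0 : R, 1]) (t ^+ m * expR (- (m%:R * t))).
Proof.
have q01 : 0 < (2^-1 : R) < 1 by rewrite invr_gt0 ltr0n invf_lt1 ?ltr1n ?ltr0n.
have /andP[q0 q1] := q01.
have := cluster_factor_le_integral m 0 q01.
have e0 : 0 < riemann_error m (2^-1 : R) by rewrite divr_gt0 ?expR_gt0 ?exprn_gt0.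
rewrite -(pmulr_rgt0 _ e0); apply: lt_le_trans.
rewrite mulr_gt0 ?exprn_gt0 ?subr_gt0 ?expr1 //.
rewrite /cluster_factor big_ord_recr big_ord0 /= add0r muln0 mul1r.
by rewrite divr_gt0 ?qrise_gt0.
Qed.

Lemma cluster_prob_upper_bulk (R : realType) (m : nat) (c alpha : R) (k : nat -> nat) :
  (0 < m)%N -> 0 < c -> 0 < alpha -> admissible m.+1 k ->
  (minn (k n) (n - k n))%:R / n%:R `^ alpha @[n --> \oo] --> +oo ->
  lesssim (cluster_prob m.+1 c alpha k)
    (fun n => (\int[lebesgue_measure]_(t in `[0 : R, 1]) (t ^+ m * expR (- (m%:R * t)))) *
       cluster_rate m.+1 c alpha n).
Proof.
move=> m0 c0 al0 kadm ky; pose q := qseq c alpha.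
set I := \int[_]_(t in _) _; have I0 : 0 < I := exp_integral_gt0 R m.
(* Half of the number of values above the block, as [mallows_cluster_le_half] requires; the bulk
   hypothesis makes it much larger than n^alpha. *)
pose r n := ((n - m - k n)./2)%N.
have z0 : q n ^+ r n @[n --> \oo] --> (0 : R).
  apply: qseq_exp_cvg0 => //; apply: (@cvgy_affine _ _ _ _ 2 m.+1 al0 isT _ ky).
  by move=> n; rewrite /r; lia.
(* This sends the factor (1 - q^k)^(m + 1) of [cluster_factor_le_integral] to 1. *)
have u0 : q n ^+ k n @[n --> \oo] --> (0 : R).
  apply: qseq_exp_cvg0 => //; apply: (@cvgy_affine _ _ _ _ 1 0 al0 isT _ ky).
  by move=> n; lia.
pose g n := (riemann_error m (q n) * I / (1 - q n ^+ k n) ^+ m.+1 + q n ^+ r n) /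
  (1 - q n ^+ r n) ^+ (m + m) / I.
have g1 : g n @[n --> \oo] --> (1 : R).
  suff : g n @[n --> \oo] --> ((1 * I / (1 - 0) ^+ m.+1 + 0) / (1 - 0) ^+ (m + m) / I : R).
    by rewrite !subr0 !expr1n !divr1 mul1r addr0 divff ?gt_eqF.
  have pow_cvg (u : nat -> R) p : u n @[n --> \oo] --> (0 : R) ->
      ((1 - u n) ^+ p)^-1 @[n --> \oo] --> (((1 - 0) ^+ p)^-1 : R).
    move=> u0'; apply: cvgV; first by rewrite subr0 expr1n oner_neq0.
    by apply: cvg_exprn; apply: cvgB => //; exact: cvg_cst.
  apply: cvgM; last exact: cvg_cst.
  apply: cvgM; last exact: pow_cvg.
  apply: cvgD => //; apply: cvgM; last exact: pow_cvg.
  by apply: cvgM; [exact/cvg_riemann_error/qseq_cvg1|exact: cvg_cst].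
apply: lesssim_near => e e0; near=> n.
have ln : (m.+1 <= n)%N by near: n; exact: nbhs_infty_ge.
have q01 : 0 < q n < 1 by near: n; exact: qseq_gt0_lt1.
have zn : q n ^+ r n < 1 by near: n; exact: cvgr_lt z0 _ ltr01.
have un : q n ^+ k n < 1 by near: n; exact: cvgr_lt u0 _ ltr01.
have gn : g n <= 1 + e by near: n; apply: cvgr_le g1 _ _; rewrite ltrDl.
have /andP[k1 kn] := kadm n ln; have /andP[q0 q1] := q01.
apply: le_trans gn; rewrite cluster_rateE -/(q n).
have rt0 : 0 < (1 - q n) ^+ m * (m.+1)`!%:R.
  by rewrite mulr_gt0 ?exprn_gt0 ?subr_gt0 // ltr0n fact_gt0.
rewrite ler_pdivrMr ?mulr_gt0 ?ltr0n ?exprn_gt0 ?subr_gt0 ?fact_gt0 //.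
rewrite /g mulrA divfK ?gt_eqF // mulrAC ler_pdivlMr ?exprn_gt0 ?subr_gt0 //.
have [d dE] : exists d, (n = (k n).-1 + d + m.+1)%N.
  by exists (n - m.+1 - (k n).-1)%N; lia.
have rd : ((r n).*2 <= d)%N by rewrite /r; lia.
have := mallows_cluster_le_half (k n).-1 q01 m0 rd.
rewrite -dE prednK // => H; apply: le_trans H _.
rewrite [leLHS]mulrC ler_wpM2r ?(ltW rt0) // lerD2r.
rewrite ler_pdivlMr ?exprn_gt0 ?subr_gt0 //.
by have := cluster_factor_le_integral m (k n).-1 q01; rewrite prednK.
Unshelve. all: by end_near. Qed.

Theorem theorem1 (R : realType) (l : nat) (c alpha : R)
    (hl : (2 <= l)%N) (hc : 0 < c) (halpha0 : 0 < alpha) (halpha1 : alpha < 1) :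
  let lower := fun n : nat =>
    (l.-1`!%:R ^+ 2 / (2 * l)`!%:R) * cluster_rate l c alpha n in
  let upper := fun n : nat => l%:R^-1 * cluster_rate l c alpha n in
  let upper' := fun n : nat =>
    (\int[lebesgue_measure]_(x in `[0 : R, 1 : R])
        (x ^+ l.-1 * expR (- (l.-1%:R * x)))) * cluster_rate l c alpha n in
  [/\ forall k : nat -> nat, admissible l k ->
        lesssim lower (cluster_prob l c alpha k) /\
        lesssim (cluster_prob l c alpha k) upper,
      lesssim_uniform [set k | admissible l k]
        (fun _ => lower) (cluster_prob l c alpha) /\
      lesssim_uniform [set k | admissible l k]
        (cluster_prob l c alpha) (fun _ => upper)
    & forall k : nat -> nat, admissible l k ->
        (minn (k n) (n - k n))%:R / n%:R `^ alpha @[n --> \oo] --> +oo ->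
        lesssim lower (cluster_prob l c alpha k) /\
        lesssim (cluster_prob l c alpha k) upper'].
Proof.
case: l hl => [//|m] hl; rewrite /=.
have m0 : (0 < m)%N by [].
have low := cluster_prob_lower m hc halpha0 halpha1.
have up := cluster_prob_upper m0 hc halpha0 halpha1.
split=> [k kadm||k kadm ky]; [split|by []|split].
- exact: lesssim_uniform_in low kadm.
- exact: lesssim_uniform_in up kadm.
- exact: lesssim_uniform_in low kadm.
- exact: cluster_prob_upper_bulk.
Qed.
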